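(* Let $d\ge2$ and let $V_o$ be the typical Poisson-Voronoi cell of a homogeneous Poisson point process with intensity $\lambda>0$ on $\mathbb{R}^d$. Let $Q_d(R,\epsilon)$ be the conditional probability, given that the inradius of $V_o$ equals $R$, that a point on the boundary of $\mathcal{B}_{R+\epsilon}(o)$ (chosen uniformly at random) does not belong to $V_o$. Then $$\lim_{R\to\infty}Q_d(R,\epsilon)=1\qquad\text{for all }\epsilon>0.$$
   Context: Let $\Phi$ be the Poisson point process. The typical cell is $V_o=\{\mathbf{y}\in\mathbb{R}^d : \|\mathbf{y}\|\le\|\mathbf{x}-\mathbf{y}\|\ \ \forall\mathbf{x}\in\Phi\}$, with nucleus the origin $o$. $\mathcal{B}_r(o)$ is the ball of radius $r$ centered at $o$. The inradius of $V_o$ is the radius of the largest ball centered at $o$ contained in $V_o$; equivalently it is $R=\frac12\min_{\mathbf{x}\in\Phi}\|\mathbf{x}\|$. Conditioning on the inradius being $R$ means: $\Phi=\{\mathbf{x}_0\}\cup\Phi'$, where $\mathbf{x}_0$ is uniformly distributed on the sphere of radius $2R$ centered at $o$, and $\Phi'$ is, independently of $\mathbf{x}_0$, a Poisson point process of intensity $\lambda$ on $\mathbb{R}^d\setminus\mathcal{B}_{2R}(o)$. The point on $\partial\mathcal{B}_{R+\epsilon}(o)$ is chosen uniformly and independently of $\Phi$. *)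

(* Defs.v *)
From HB Require Import structures.
From mathcomp Require Import all_boot all_order all_algebra.
From mathcomp Require Import all_classical all_reals all_analysis.
From mathcomp Require Import measurable_realfun.

Set Implicit Arguments.
Unset Strict Implicit.
Unset Printing Implicit Defensive.

Import Order.TTheory GRing.Theory Num.Theory.
Import numFieldNormedType.Exports.

Local Open Scope classical_set_scope.
Local Open Scope ring_scope.

(* R^d is d.-tuple R: it carries the product (= Borel) sigma-algebra, which
   'rV[R]_d does not, and the norm of 'rV[R]_d would be the sup norm anyway. *)
Section lebesgue_tuple.
Context {R : realType}.

Definition consp (n : nat) (xy : measurableTypeR R * n.-tuple R) :
  n.+1.-tuple R := [tuple of (xy.1 : R) :: xy.2].

Lemma measurable_consp n : measurable_fun setT (@consp n).
Proof.
apply: (@measurable_cons _ _ _ R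
  (fun xy : measurableTypeR R * n.-tuple R => xy.1 : R) n snd).
- apply: (@measurableT_comp _ _ _ (measurableTypeR R * n.-tuple R)%type
    (measurableTypeR R) R (fun x => x)).
    by move=> _ Y mY; rewrite setTI.
  exact: measurable_fst.
- exact: measurable_snd.
Qed.

Definition unconsp (n : nat) (x : n.+1.-tuple R) :
  measurableTypeR R * n.-tuple R := (thead x, [tuple of behead x]).

Lemma measurable_unconsp n : measurable_fun setT (@unconsp n).
Proof.
apply: measurable_fun_pair; last exact: measurable_behead.
apply: (@measurableT_comp _ _ _ (n.+1.-tuple R) R (measurableTypeR R)
    (fun x => x)).
  by move=> _ Y mY; rewrite setTI.
exact: measurable_tnth.
Qed.

Lemma conspK n : cancel (@consp n) (@unconsp n).
Proof.
move=> [a x]; rewrite /consp /unconsp; congr pair.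
by apply: val_inj.
Qed.

Section step.
Local Open Scope ereal_scope.
Context (n : nat) (m : {sigma_finite_measure set (n.-tuple R) -> \bar R}).

Definition cons_measure : set (n.+1.-tuple R) -> \bar R :=
  pushforward (lebesgue_measure \x m) (@consp n).

Let mc A : measurable A -> measurable (@consp n @^-1` A).
Proof. by move=> mA; rewrite -[X in measurable X]setTI; exact: measurable_consp. Qed.

Let cons_measure0 : cons_measure set0 = 0.
Proof. by rewrite /cons_measure /pushforward preimage_set0 measure0. Qed.

Let cons_measure_ge0 A : 0 <= cons_measure A.
Proof. exact: (measure_ge0 (lebesgue_measure \x m : {measure set _ -> \bar R})). Qed.

Let cons_measure_sigma_additive : semi_sigma_additive cons_measure.
Proof.
move=> F mF tF mUF; rewrite /cons_measure /pushforward preimage_bigcup.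
apply: (@measure_semi_sigma_additive _ _ _ (lebesgue_measure \x m)).
- by move=> i; exact: mc.
- apply/trivIsetP => /= i j _ _ ij; rewrite -preimage_setI.
  by move/trivIsetP : tF => /(_ _ _ _ _ ij) ->//; rewrite preimage_set0.
- by rewrite -preimage_bigcup; exact: mc.
Qed.

HB.instance Definition _ := isMeasure.Build _ _ _ cons_measure
  cons_measure0 cons_measure_ge0 cons_measure_sigma_additive.

Let cons_measure_sigma_finite : sigma_finite setT cons_measure.
Proof.
have /sigma_finiteP[F [TF ndF Foo]] := sigma_finiteT (@lebesgue_measure R).
have /sigma_finiteP[G [TG ndG Goo]] := sigma_finiteT m.
exists (fun k => @unconsp n @^-1` (F k `*` G k)).
  rewrite -preimage_bigcup; apply/esym/seteqP; split=> // x _ /=.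
  have [i _ Fi] : (\bigcup_k F k) (unconsp x).1 by rewrite -TF.
  have [j _ Gj] : (\bigcup_k G k) (unconsp x).2 by rewrite -TG.
  exists (maxn i j) => //; split.
    by move: Fi; exact/subsetPset/ndF/leq_maxl.
  by move: Gj; exact/subsetPset/ndG/leq_maxr.
move=> k; have [mF Fk] := Foo k; have [mG Gk] := Goo k; split.
  by rewrite -[X in measurable X]setTI; apply: measurable_unconsp => //;
    exact: measurableX.
rewrite /cons_measure /pushforward (_ : _ @^-1` _ = F k `*` G k); last first.
  by rewrite -comp_preimage (_ : _ \o _ = id)//; apply/funext/conspK.
by rewrite product_measure1E// lte_mul_pinfty// ge0_fin_numE.
Qed.

HB.instance Definition _ := @Measure_isSigmaFinite.Build _ _ _ cons_measure
  cons_measure_sigma_finite.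

End step.

Fixpoint lebesgue_tuple (n : nat) :
    {sigma_finite_measure set (n.-tuple R) -> \bar R} :=
  match n with
  | 0 => \d_([tuple] : 0.-tuple R)
  | n'.+1 => cons_measure (lebesgue_tuple n')
  end.

Lemma lebesgue_tuple_box (n : nat) (A : 'I_n -> set R) :
  (forall i, measurable (A i)) ->
  lebesgue_tuple n [set x | forall i, A i (tnth x i)] =
  (\prod_(i < n) lebesgue_measure (A i))%E.
Proof.
elim: n A => [|n IH] A mA /=.
  by rewrite big_ord0 diracE mem_set//= => -[].
rewrite big_ord_recl -IH// /cons_measure/= /pushforward.
rewrite -product_measure1E//; first last.
  rewrite (_ : [set x : n.-tuple R | _] =
    \bigcap_(i in [set: 'I_n]) ((@tnth n R)^~ i @^-1` A (lift ord0 i))).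
    apply: fin_bigcap_measurable => // i _.
    by rewrite -[X in measurable X]setTI; exact: measurable_tnth.
  by apply/seteqP; split => x /= h i => [_|]; exact: h.
  exact: mA.
congr (product_measure1 _ _ _); apply/seteqP; split => -[a x]/=.
  move=> h; split; first exact: (h ord0).
  by move=> i; have := h (lift ord0 i); rewrite tnthS.
move=> [ha hx] i; case: (unliftP ord0 i) => [j|] ->; last exact: ha.
by rewrite tnthS; exact: hx.
Qed.

End lebesgue_tuple.

Section euclidean.
Context {R : realType} {d : nat}.
Implicit Types (x y : d.-tuple R) (r : R).

Definition enorm x : R := Num.sqrt (\sum_(i < d) tnth x i ^+ 2).

Definition edist x y : R :=
  Num.sqrt (\sum_(i < d) (tnth x i - tnth y i) ^+ 2).

Definition escale (a : R) x : d.-tuple R := [tuple a * tnth x i | i < d].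

Definition eball r : set (d.-tuple R) := [set x | enorm x <= r].

Definition voronoi_cell (Phi : set (d.-tuple R)) : set (d.-tuple R) :=
  [set y | forall x, Phi x -> enorm y <= edist x y].

End euclidean.

Section random_elements.
Context {R : realType} {disp : measure_display} {T : measurableType disp}.
Context (P : probability T R).

(* Mutual independence of n sub-sigma-algebras; the product rule for a
   subfamily is the case where the other events are setT. *)
Definition independent_sigma n (F : 'I_n -> set (set T)) : Prop :=
  forall E : 'I_n -> set T, (forall i, F i (E i)) ->
    P (\bigcap_(i in [set: 'I_n]) E i) = (\prod_(i < n) P (E i))%E.

Definition sigma_rv d' (T' : measurableType d') (X : T -> T') : set (set T) :=
  preimage_set_system setT X measurable.

(* Uniform on the sphere of radius r centred at the origin: the normalised
   surface measure of a Borel set A is the fraction of the volume of the ball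
   occupied by the points x whose radial projection r x / |x| lies in A. *)
Definition uniform_on_sphere d (r : R) (X : T -> d.-tuple R) : Prop :=
  measurable_fun setT X /\
  forall A : set (d.-tuple R), measurable A ->
    (P (X @^-1` A) * lebesgue_tuple d (eball r) =
     lebesgue_tuple d
       [set x | (0 < enorm x <= r)%R /\ A (escale (r / enorm x) x)])%E.

Section point_process.
Context {d : nat}.
Implicit Types (Phi : T -> set (d.-tuple R)) (B D : set (d.-tuple R)).

Definition npoints Phi B (w : T) : \bar R := counting (Phi w `&` B).

Definition point_process Phi : Prop :=
  (forall w r, finite_set (Phi w `&` eball r)) /\
  (forall B, measurable B -> measurable_fun setT (npoints Phi B)).

Definition sigma_pp Phi : set (set T) :=
  <<s \bigcup_(B in measurable) sigma_rv (npoints Phi B) >>.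

(* Homogeneous Poisson point process of intensity lambda on D.  The law is
   given through poisson_prob rather than poisson_pmf, whose value at rate 0
   is 1 for every k; the first nat argument of poisson_prob is a dummy. *)
Definition poisson_process (lambda : R) D Phi : Prop :=
  [/\ point_process Phi,
      forall w, Phi w `<=` D,
      forall B, measurable B -> B `<=` D ->
        (lebesgue_tuple d B < +oo)%E -> forall k : nat,
        P [set w | npoints Phi B w = (k%:R)%:E] =
        poisson_prob (lambda * fine (lebesgue_tuple d B)) 0 [set k] &
      forall n (B : 'I_n -> set (d.-tuple R)),
        (forall i, measurable (B i)) -> (forall i, B i `<=` D) ->
        trivIset setT B ->
        independent_sigma (fun i => sigma_rv (npoints Phi (B i)))].

End point_process.

(* The process conditioned on inradius r is [set X0 w] `|` Phi' w, where X0 is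
   the nearest point to the origin; Y is the test point. *)
Record inradius_model (d : nat) (lambda r eps : R) (X0 : T -> d.-tuple R)
    (Phi' : T -> set (d.-tuple R)) (Y : T -> d.-tuple R) : Prop := {
  nearest_uniform : uniform_on_sphere (2 * r) X0 ;
  rest_poisson : poisson_process lambda (~` eball (2 * r)) Phi' ;
  test_uniform : uniform_on_sphere (r + eps) Y ;
  model_independent : independent_sigma
    (tnth [tuple sigma_rv X0; sigma_pp Phi'; sigma_rv Y]) }.

End random_elements.

(* q is the conditional probability, given that the inradius is r, that a
   uniform point of the sphere of radius r + eps is outside the typical cell.
   It depends only on the joint law of the model, so any model computes it. *)
Definition is_escape_probability (R : realType) (d : nat) (lambda r eps q : R) :
    Prop :=
  exists (disp : measure_display) (T : measurableType disp)
    (P : probability T R) (X0 : T -> d.-tuple R)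
    (Phi' : T -> set (d.-tuple R)) (Y : T -> d.-tuple R),
    inradius_model P lambda r eps X0 Phi' Y /\
    P [set w | ~ voronoi_cell ([set X0 w] `|` Phi' w) (Y w)] = q%:E.

(* Main.v *)
From Pilot Require Import Defs.
From HB Require Import structures.
From mathcomp Require Import all_boot all_order all_algebra.
From mathcomp Require Import all_classical all_reals all_analysis.
From mathcomp Require Import measurable_realfun.
From mathcomp Require Import ring lra.
Import Pilot.Defs.
Import Order.TTheory GRing.Theory Num.Theory.
Import numFieldNormedType.Exports.
Local Open Scope classical_set_scope.
Local Open Scope ring_scope.

(** Let [s = r + eps] be the norm of the test point [y]. The point [y] is outside
    the cell as soon as some point of the process lies in the crescent formed
    by the [x] with [|x - y| < |y|] and [|x| > 2 r]. At its tip the crescent is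
    [2 eps] thick, and it extends over a distance of order [sqrt (r eps)]
    orthogonally to [y], a direction that exists because [d >= 2]. Its volume
    therefore tends to infinity with [r], so the Poisson process, which has
    expected number of points [lambda] times that volume, misses it with
    probability tending to [0].

    The volume is bounded below without computing it: [crescent_points] gives
    [K] points at mutual distance at least [eps], spread along a line orthogonal
    to [y] and at distance at least [eps / 2] from the boundary of the crescent;
    this is possible once [r >= K ^ 2 eps]. The disjoint cubes of a fixed size
    around them stay inside the crescent even when [y] moves by less than
    [eps / 4] on its sphere ([crescent_volume]).

    This margin also avoids integrating over the law of [y]. The space is cut
    into countably many Borel cells of diameter less than [eps / 4]; for a cell
    [C], the event that [y] is in [C] and in the Voronoi cell forces the process
    to miss a region that depends on [C] only. By independence the probability
    is at most [exp (- lambda v)] times that of [y] being in [C]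
    ([cell_no_escape]), where [v] is proportional to [K], and summing over the
    cells gives the same bound for the whole ([no_escape_le]). As [K] is
    arbitrary, the limit follows. The bound is meaningful because the escape
    event is measurable ([measurable_escape]). *)

(** * Euclidean geometry *)

(** Lagrange's identity: twice the difference of the two sides is the double
    sum of the squares [(f i * g j - f j * g i) ^+ 2]. *)
Lemma cauchy_schwarz_sum (R : realType) (d : nat) (f g : 'I_d -> R) :
  (\sum_i f i * g i) ^+ 2 <= (\sum_i f i ^+ 2) * (\sum_i g i ^+ 2).
Proof.
have -> : (\sum_i f i * g i) ^+ 2 =
    \sum_i \sum_j (f i * g i) * (f j * g j).
  by rewrite expr2 mulr_suml; apply: eq_bigr => i _; rewrite mulr_sumr.
have E : (\sum_i f i ^+ 2) * (\sum_i g i ^+ 2) =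
    \sum_i \sum_j f i ^+ 2 * g j ^+ 2.
  by rewrite mulr_suml; apply: eq_bigr => i _; rewrite mulr_sumr.
have E' : (\sum_i f i ^+ 2) * (\sum_i g i ^+ 2) =
    \sum_i \sum_j f j ^+ 2 * g i ^+ 2 by rewrite E exchange_big.
rewrite -(ler_pM2l (ltr0n R 2)) mulr_natl [leRHS]mulr_natl !mulr2n.
rewrite [X in _ <= X + _]E [X in _ <= _ + X]E' -!big_split /=.
apply: ler_sum => i _; rewrite -!big_split /=; apply: ler_sum => j _.
by rewrite -subr_ge0; have := sqr_ge0 (f i * g j - f j * g i); nra.
Qed.

Lemma minkowski_sum (R : realType) (d : nat) (f g : 'I_d -> R) :
  Num.sqrt (\sum_i (f i + g i) ^+ 2) <=
  Num.sqrt (\sum_i f i ^+ 2) + Num.sqrt (\sum_i g i ^+ 2).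
Proof.
have F0 : 0 <= \sum_i f i ^+ 2 by apply: sumr_ge0 => i _; exact: sqr_ge0.
have G0 : 0 <= \sum_i g i ^+ 2 by apply: sumr_ge0 => i _; exact: sqr_ge0.
have -> : \sum_i (f i + g i) ^+ 2 =
    \sum_i f i ^+ 2 + (\sum_i f i * g i) *+ 2 + \sum_i g i ^+ 2.
  by rewrite -sumrMnl -!big_split; apply: eq_bigr => i _; rewrite /= sqrrD.
rewrite -[leRHS]ger0_norm ?addr_ge0 ?sqrtr_ge0// -sqrtr_sqr ler_wsqrtr//.
rewrite sqrrD !sqr_sqrtr// lerD2r lerD2l lerMn2r /=.
rewrite -sqrtrM//; apply: le_trans (ler_norm _) _.
by rewrite -sqrtr_sqr ler_wsqrtr// cauchy_schwarz_sum.
Qed.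

Section euclidean_metric.
Context {R : realType} {d : nat}.
Implicit Types (x y z : d.-tuple R).

Lemma enorm_sqr x : enorm x ^+ 2 = \sum_(i < d) tnth x i ^+ 2.
Proof. by rewrite sqr_sqrtr// sumr_ge0// => i _; exact: sqr_ge0. Qed.

Lemma edistC x y : edist x y = edist y x.
Proof. by congr Num.sqrt; apply: eq_bigr => i _; rewrite -sqrrN opprB. Qed.

Lemma edist_triangle y x z : edist x z <= edist x y + edist y z.
Proof.
apply: le_trans (minkowski_sum _ _ _ _); rewrite le_eqVlt; apply/orP; left.
by apply/eqP; congr Num.sqrt; apply: eq_bigr => i _; congr (_ ^+ 2); ring.
Qed.

Lemma enorm_le_edist x y : enorm x <= edist x y + enorm y.
Proof.
apply: le_trans (minkowski_sum _ _ _ _); rewrite le_eqVlt; apply/orP; left.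
by apply/eqP; congr Num.sqrt; apply: eq_bigr => i _; congr (_ ^+ 2); ring.
Qed.

Lemma enorm_escale (a : R) x : 0 <= a -> enorm (escale a x) = a * enorm x.
Proof.
move=> a0; rewrite /enorm -[X in X * _]ger0_norm// -sqrtr_sqr -sqrtrM ?sqr_ge0//.
congr Num.sqrt; rewrite mulr_sumr; apply: eq_bigr => i _.
by rewrite tnth_mktuple exprMn.
Qed.

(** A cube lies in the ball of the same centre; [d] stands for the optimal
    [sqrt d], which saves a root. *)
Lemma edist_le_coord (eta : R) x y : 0 <= eta ->
  (forall i, `|tnth x i - tnth y i| <= eta) -> edist x y <= d%:R * eta.
Proof.
move=> eta0 H.
rewrite -[leRHS]ger0_norm ?mulr_ge0// -sqrtr_sqr ler_wsqrtr//.
apply: (@le_trans _ _ (\sum_(i < d) eta ^+ 2)).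
  by apply: ler_sum => i _; rewrite -real_normK ?num_real// lerXn2r ?nnegrE.
rewrite sumr_const card_ord -[leLHS]mulr_natl exprMn ler_wpM2r ?sqr_ge0//.
by rewrite -natrX ler_nat; case: (d) => // n; rewrite expnS leq_pmulr.
Qed.

(** A quarter turn of [y] in the plane of two coordinates is orthogonal to
    [y]; it vanishes only if both coordinates do, and then a basis vector of
    that plane serves. *)
Lemma orthogonal_unit y : (2 <= d)%N ->
  exists v : d.-tuple R, \sum_i tnth y i * tnth v i = 0 /\ enorm v = 1.
Proof.
move=> d2.
suff [w [yw w0]] : exists w : 'I_d -> R,
    \sum_i tnth y i * w i = 0 /\ 0 < \sum_i w i ^+ 2.
  have n0 : 0 < Num.sqrt (\sum_i w i ^+ 2) by rewrite sqrtr_gt0.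
  exists [tuple w i / Num.sqrt (\sum_i w i ^+ 2) | i < d]; split.
    under eq_bigr do rewrite tnth_mktuple mulrA.
    by rewrite -mulr_suml yw mul0r.
  rewrite /enorm (_ : \sum_(i < d) _ = 1) ?sqrtr1//.
  under eq_bigr do rewrite tnth_mktuple exprMn.
  by rewrite -mulr_suml exprVn sqr_sqrtr ?ltW// divff ?gt_eqF.
have [i0 [i1 i10]] : exists i0 i1 : 'I_d, i1 != i0.
  by exists (Ordinal (ltnW d2)), (Ordinal d2).
have [y0|y0] := eqVneq (tnth y i0) 0.
  exists (fun i => (i == i0)%:R); split.
    by rewrite (bigD1 i0)//= y0 mul0r add0r big1// => i /negPf ->; rewrite mulr0.
  by rewrite (bigD1 i0)//= eqxx big1 ?addr0 ?expr1n// => i /negPf ->; rewrite expr0n.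
exists (fun i => if i == i0 then - tnth y i1 else if i == i1 then tnth y i0 else 0).
split.
  rewrite (bigD1 i0)//= eqxx (bigD1 i1)//= (negPf i10) eqxx big1; last first.
    by move=> i /andP[/negPf -> /negPf ->]; rewrite mulr0.
  by rewrite addr0; ring.
rewrite (bigD1 i0)//= (bigD1 i1)//= (negPf i10) !eqxx.
rewrite ltr_wpDl ?sqr_ge0// ltr_wpDr ?sumr_ge0// => [i _|].
  exact: sqr_ge0.
by rewrite lt0r sqrf_eq0 y0 sqr_ge0.
Qed.

End euclidean_metric.

Lemma sum_sqr_orthogonal (R : realType) (d : nat) (a b : R) (y v : d.-tuple R) :
  \sum_i tnth y i * tnth v i = 0 -> enorm v = 1 ->
  \sum_i (a * tnth y i + b * tnth v i) ^+ 2 = (a * enorm y) ^+ 2 + b ^+ 2.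
Proof.
move=> yv v1.
have -> : b ^+ 2 = b ^+ 2 * enorm v ^+ 2 by rewrite v1 expr1n mulr1.
transitivity (a ^+ 2 * enorm y ^+ 2 + b ^+ 2 * enorm v ^+ 2 +
    2 * a * b * \sum_i tnth y i * tnth v i); last by rewrite yv; ring.
rewrite !enorm_sqr !mulr_sumr -!big_split/=.
by apply: eq_bigr => i _; ring.
Qed.

(** With [v] a unit vector orthogonal to [y], the points are
    [(2 r + eps) y / |y| + k eps v]. Pythagoras gives
    [|c k - y| ^ 2 = r ^ 2 + (k eps) ^ 2], which is at most
    [(r + eps / 2) ^ 2] as long as [k ^ 2 eps <= r]. The membership conditions
    of the crescent hold here with margins [eps] and [eps / 2]. *)
Lemma crescent_points (R : realType) (d : nat) (r eps : R) (K : nat)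
    (y : d.-tuple R) : (2 <= d)%N -> 0 < r -> 0 < eps ->
  K%:R ^+ 2 * eps <= r -> enorm y = r + eps ->
  exists c : nat -> d.-tuple R,
    [/\ forall k, 2 * r + eps <= enorm (c k),
        forall k, (k < K)%N -> edist (c k) y <= r + eps / 2 &
        forall k l, k <> l -> eps <= edist (c k) (c l)].
Proof.
move=> d2 r0 eps0 Kr ynorm.
have [v [yv v1]] := orthogonal_unit y d2.
have s0 : r + eps != 0 by rewrite gt_eqF// addr_gt0.
exists (fun k => [tuple (2 * r + eps) / (r + eps) * tnth y i +
                        (k%:R * eps) * tnth v i | i < d]); split.
- move=> k; rewrite /enorm.
  under eq_bigr do rewrite tnth_mktuple.
  rewrite sum_sqr_orthogonal// ynorm divfK//.
  rewrite -[leLHS]ger0_norm; last by lra.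
  by rewrite -sqrtr_sqr ler_wsqrtr// lerDl sqr_ge0.
- move=> k kK; rewrite /edist.
  have -> : \sum_(i < d) (tnth [tuple (2 * r + eps) / (r + eps) * tnth y i +
       k%:R * eps * tnth v i | i < d] i - tnth y i) ^+ 2 =
     \sum_(i < d) (r / (r + eps) * tnth y i + (k%:R * eps) * tnth v i) ^+ 2.
    by apply: eq_bigr => i _; rewrite tnth_mktuple; congr (_ ^+ 2); field.
  rewrite sum_sqr_orthogonal// ynorm divfK//.
  rewrite -[leRHS]ger0_norm; last by lra.
  rewrite -sqrtr_sqr ler_wsqrtr//.
  have kK' : k%:R ^+ 2 <= K%:R ^+ 2 :> R.
    by rewrite -!natrX ler_nat leq_exp2r// ltnW.
  have H : k%:R ^+ 2 * eps <= r by apply: le_trans Kr; rewrite ler_wpM2r// ltW.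
  have : k%:R ^+ 2 * eps * eps <= r * eps by rewrite ler_wpM2r// ltW.
  by have := sqr_ge0 eps; nra.
- move=> k l kl; rewrite /edist.
  have -> : \sum_(i < d) (tnth [tuple (2 * r + eps) / (r + eps) * tnth y i +
         k%:R * eps * tnth v i | i < d] i -
      tnth [tuple (2 * r + eps) / (r + eps) * tnth y i +
         l%:R * eps * tnth v i | i < d] i) ^+ 2 =
     \sum_(i < d) (0 * tnth y i + ((k%:R - l%:R) * eps) * tnth v i) ^+ 2.
    by apply: eq_bigr => i _; rewrite !tnth_mktuple; congr (_ ^+ 2); ring.
  rewrite sum_sqr_orthogonal// mul0r expr0n add0r sqrtr_sqr normrM.
  rewrite [X in _ * X]gtr0_norm// ler_peMl ?(ltW eps0)//.
  have -> : k%:R - l%:R = (k%:Z - l%:Z)%:~R :> R by rewrite rmorphB.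
  rewrite -intr_norm ler1z -gtz0_ge1 normr_gt0 subr_eq0.
  by apply/eqP => -[].
Qed.

(** * Lebesgue volume and Borel measurability *)

Section tuple_measure.
Context {R : realType} {d : nat}.
Implicit Types (x y c : d.-tuple R).

Definition cube c (eta : R) : set (d.-tuple R) :=
  [set x | forall i, `](tnth c i - eta), (tnth c i + eta)[%classic (tnth x i)].

Lemma measurable_cube c eta : measurable (cube c eta).
Proof.
rewrite (_ : cube c eta = \bigcap_(i in [set: 'I_d])
  ((@tnth d R)^~ i @^-1` `](tnth c i - eta), (tnth c i + eta)[)).
  apply: fin_bigcap_measurable => // i _.
  by rewrite -[X in measurable X]setTI; exact: measurable_tnth.
by apply/seteqP; split => x /= h i => [_|]; exact: h.
Qed.

Lemma lebesgue_cube c eta : 0 < eta ->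
  lebesgue_tuple d (cube c eta) = ((2 * eta) ^+ d)%:E.
Proof.
move=> eta0; rewrite /cube.
rewrite (lebesgue_tuple_box (A := fun i => `](tnth c i - eta), (tnth c i + eta)[%classic))//.
under eq_bigr => i _.
  rewrite lebesgue_measure_itv/= lte_fin ifT; last by lra.
  rewrite -EFinD (_ : tnth c i + eta - _ = 2 * eta); last by ring.
  over.
by rewrite prodEFin prodr_const card_ord.
Qed.

Lemma cube_edist c eta x : 0 <= eta -> cube c eta x -> edist x c <= d%:R * eta.
Proof.
move=> eta0 cx; apply: edist_le_coord => // i.
by have := cx i; rewrite /= in_itv/= ler_norml => /andP[]; lra.
Qed.

Lemma measurable_edist (disp : measure_display) (T : measurableType disp)
    (X Y : T -> d.-tuple R) :
  measurable_fun setT X -> measurable_fun setT Y ->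
  measurable_fun setT (fun w => edist (X w) (Y w)).
Proof.
move=> mX mY.
have mS : measurable_fun setT
    (fun w => \sum_(i < d) (tnth (X w) i - tnth (Y w) i) ^+ 2).
  apply: measurable_sum => i; apply: measurable_funX.
  by apply: measurable_funB;
    [exact: (measurableT_comp (measurable_tnth i) mX)
    |exact: (measurableT_comp (measurable_tnth i) mY)].
exact: (measurableT_comp (continuous_measurable_fun (@sqrt_continuous R)) mS).
Qed.

Lemma measurable_enorm (disp : measure_display) (T : measurableType disp)
    (X : T -> d.-tuple R) :
  measurable_fun setT X -> measurable_fun setT (fun w => enorm (X w)).
Proof.
move=> mX.
have mS : measurable_fun setT (fun w => \sum_(i < d) tnth (X w) i ^+ 2).
  apply: measurable_sum => i; apply: measurable_funX.
  exact: (measurableT_comp (measurable_tnth i) mX).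
exact: (measurableT_comp (continuous_measurable_fun (@sqrt_continuous R)) mS).
Qed.

Lemma dense_sequence : exists p : nat -> d.-tuple R,
  forall rho y, 0 < rho -> exists n, edist y (p n) < rho.
Proof.
exists (fun n => if unpickle n is Some q then
  [tuple ratr (tnth (q : d.-tuple rat) i) | i < d] else [tuple 0 | i < d]).
move=> rho y rho0; pose h := rho / d.+1%:R.
have h0 : 0 < h by rewrite divr_gt0.
have /fin_all_exists[q qy] : forall i, exists q : rat,
    ratr q \in `](tnth y i - h), (tnth y i + h)[.
  by move=> i; apply: rat_in_itvoo; lra.
exists (pickle [tuple q i | i < d]); rewrite pickleK.
apply: (@le_lt_trans _ _ (d%:R * h)).
  apply: edist_le_coord; first exact: ltW.
  move=> i; rewrite !tnth_mktuple; have := qy i; rewrite in_itv/= => /andP[].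
  by rewrite ler_norml; lra.
rewrite /h mulrCA gtr_pMr// ltr_pdivrMr// mul1r ltr_nat//.
Qed.

End tuple_measure.

Lemma ltr_set_measurable (R : realType) (disp : measure_display)
    (T : measurableType disp) (f g : T -> R) :
  measurable_fun setT f -> measurable_fun setT g ->
  measurable [set w | f w < g w].
Proof.
move=> mf mg; rewrite -[X in measurable X]setTI.
exact: (measurable_fun_ltr mf mg).
Qed.

(** The law of a uniform point on a sphere is given by an equation multiplied by
    the volume of the ball; positivity of that volume makes it usable. *)
Lemma eball_volume_gt0 (R : realType) (d : nat) (s : R) : 0 < s ->
  (0 < lebesgue_tuple d (eball s))%E.
Proof.
move=> s0; pose eta := s / d.+1%:R; pose o : d.-tuple R := [tuple 0 | i < d].
have eta0 : 0 < eta by rewrite divr_gt0.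
have o0 : enorm o = 0.
  by rewrite /enorm big1 ?sqrtr0// => i _; rewrite tnth_mktuple expr0n.
apply: (@lt_le_trans _ _ (lebesgue_tuple d (cube o eta))).
  by rewrite lebesgue_cube// lte_fin exprn_gt0// mulr_gt0.
apply: le_measure; rewrite ?inE.
- exact: measurable_cube.
- rewrite (_ : eball s = ~` [set x | s < enorm x]); last first.
    by apply/seteqP; split => x; rewrite /eball/= leNgt => /negP.
  apply: measurableC; apply: ltr_set_measurable => //.
  exact: measurable_enorm.
- move=> x /(cube_edist _ _ _ (ltW eta0)) H; rewrite /eball/=.
  apply: le_trans (enorm_le_edist x o) _; rewrite o0 addr0.
  apply: le_trans H _.
  by rewrite /eta mulrCA ger_pMr// ler_pdivrMr// mul1r ler_nat.
Qed.

(** [B] is a union of disjoint cubes around the points of [crescent_points] for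
    [y0]. The half-side [eps / (8 d)] puts each cube in a ball of radius
    [eps / 8]. Together with the displacement [eps / 4] of the test point, this
    uses less than the margin [eps / 2]. *)
Lemma crescent_volume (R : realType) (d : nat) (r eps : R) (K : nat)
    (y0 : d.-tuple R) : (2 <= d)%N -> 0 < r -> 0 < eps ->
  K%:R ^+ 2 * eps <= r -> enorm y0 = r + eps ->
  exists B : set (d.-tuple R),
    [/\ measurable B, B `<=` ~` eball (2 * r),
        lebesgue_tuple d B = (K%:R * (eps / (4 * d%:R)) ^+ d)%:E &
        forall x y, B x -> enorm y = r + eps -> edist y0 y < eps / 4 ->
          edist x y < enorm y].
Proof.
move=> d2 r0 eps0 Kr y0norm.
have [c [cfar cnear csep]] := crescent_points R d r eps K y0 d2 r0 eps0 Kr y0norm.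
have d0 : 0 < d%:R :> R by rewrite ltr0n (ltn_trans _ d2).
pose eta := eps / (8 * d%:R).
have eta0 : 0 < eta by rewrite divr_gt0// mulr_gt0.
have cubec k x : cube (c k) eta x -> edist x (c k) <= eps / 8.
  move=> /(cube_edist _ _ _ (ltW eta0)) /le_trans; apply.
  by rewrite le_eqVlt; apply/orP; left; apply/eqP; rewrite /eta; field; lra.
exists (\big[setU/set0]_(k < K) cube (c k) eta); split.
- by apply: bigsetU_measurable => k _; exact: measurable_cube.
- rewrite -(bigcup_mkord _ (fun k => cube (c k) eta)) => x [k /= kK] /cubec xk.
  have := enorm_le_edist (c k) x; rewrite edistC; have := cfar k.
  by rewrite /eball/= => *; apply/negP; rewrite -ltNge; lra.
- rewrite (measure_bigsetU_ord (lebesgue_tuple d) xpredT (F := fun k : 'I_K => cube (c k) eta)).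
  + transitivity (\sum_(k < K) ((2 * eta) ^+ d)%:E)%E.
      by apply: eq_bigr => k _; exact: lebesgue_cube.
    rewrite sumEFin sumr_const card_ord; congr EFin.
    rewrite -[LHS]mulr_natl; congr (_ * _ ^+ _).
    by rewrite /eta; field; lra.
  + by move=> k; exact: measurable_cube.
  + move=> k l _ _ [x [/cubec xk /cubec xl]]; apply/val_inj/eqP; apply: contraT.
    move=> /eqP /csep; have := edist_triangle x (c k) (c l).
    by rewrite (edistC (c k) x); lra.
- move=> x y; rewrite -(bigcup_mkord _ (fun k => cube (c k) eta)).
  move=> [k /= kK] /cubec xk ->.
  have := edist_triangle (c k) x y; have := edist_triangle y0 (c k) y.
  by have := cnear k kK; lra.
Qed.

(** * Void events of a point process *)

Lemma counting_eq0 (R : realType) (T : choiceType) (X : set T) :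
  counting X = 0%:E :> \bar R <-> X = set0.
Proof.
rewrite /counting; split => [|->].
  case: ifPn => // /asboolP fX [] /eqP; rewrite pnatr_eq0 => /eqP X0.
  exact: (fset_set_set0 fX (finmap.cardfs0_eq X0)).
by rewrite ifT ?fset_set0//; apply/asboolP.
Qed.

Section void_events.
Context {R : realType} {disp : measure_display} {T : measurableType disp}.
Context (P : probability T R) {d : nat}.
Implicit Types (Phi : T -> set (d.-tuple R)) (B : set (d.-tuple R)).

Definition void Phi B : set T := [set w | Phi w `&` B = set0].

Lemma voidE Phi B :
  void Phi B = npoints (R := R) Phi B @^-1` [set 0%:E].
Proof. by apply/seteqP; split => w /=; rewrite /npoints counting_eq0. Qed.

Lemma measurable_void Phi B :
  point_process Phi -> measurable B -> measurable (void Phi B).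
Proof.
move=> [_ mPhi] mB; rewrite voidE -[X in measurable X]setTI.
by apply: mPhi => //; exact: emeasurable_set1.
Qed.

Lemma sigma_pp_void Phi B : measurable B -> sigma_pp Phi (void Phi B).
Proof.
move=> mB; apply: sub_sigma_algebra; exists B => //.
by exists [set 0%:E]; [exact: emeasurable_set1|rewrite setTI voidE].
Qed.

Lemma poisson_void (lambda v : R) D Phi B :
  poisson_process P lambda D Phi -> measurable B -> B `<=` D ->
  lebesgue_tuple d B = v%:E -> 0 < lambda * v ->
  P (void Phi B) = (expR (- (lambda * v)))%:E.
Proof.
move=> [_ _ law _] mB BD vB v0.
have := law B mB BD; rewrite vB ltry => /(_ isT 0%N).
rewrite /poisson_prob/= v0 esum_set1 ?lee_fin ?poisson_pmf_ge0//.
rewrite /poisson_pmf v0 expr0 mul1r fact0 invr1 mul1r => <-.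
by rewrite voidE.
Qed.

(** The condition [|x - y| < |y|] is open in [(x, y)], so it can be tested on
    countably many products of balls, with centres [p] and radii [1 / m]: this
    reduces the event to countably many void events of [Phi]. *)
Lemma measurable_exists_closer Phi (Y : T -> d.-tuple R) :
  point_process Phi -> measurable_fun setT Y ->
  measurable [set w | exists2 x, Phi w x & edist x (Y w) < enorm (Y w)].
Proof.
move=> ppPhi mY; have [p pdense] := @dense_sequence R d.
pose B m n := [set x | edist x (p n) < enorm (p n) - 2 / m.+1%:R].
have mB m n : measurable (B m n).
  by apply: ltr_set_measurable => //; exact: measurable_edist.
rewrite (_ : [set w | _] = \bigcup_m \bigcup_n
  ([set w | edist (Y w) (p n) < m.+1%:R^-1] `&` ~` void Phi (B m n))); last first.
  apply/seteqP; split => w /=.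
    move=> [x Phix xy]; pose g := enorm (Y w) - edist x (Y w).
    have g0 : 0 < g by rewrite subr_gt0.
    have [m] := ltr_add_invr (divr_gt0 g0 (ltr0n R 4)).
    rewrite add0r => mg.
    have [n yn] := pdense m.+1%:R^-1 (Y w) ltac:(by rewrite invr_gt0).
    exists m => //; exists n => //; split => // void_w.
    suff : (Phi w `&` B m n) x by rewrite void_w.
    split => //; rewrite /B /=.
    have := edist_triangle (Y w) x (p n); have := enorm_le_edist (Y w) (p n).
    by move: mg yn; rewrite /g; move: (m.+1%:R^-1) => h; lra.
  move=> [m _ [n _ [/= yp /eqP/set0P[x [Phix]]]]]; rewrite /B/= => xp.
  exists x => //; have := edist_triangle (p n) x (Y w).
  by have := enorm_le_edist (p n) (Y w); rewrite (edistC (p n) (Y w));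
    move: yp xp; move: (m.+1%:R^-1) => h; lra.
apply: bigcup_measurable => m _; apply: bigcup_measurable => n _.
apply: measurableI; last by apply: measurableC; exact: measurable_void.
by apply: ltr_set_measurable => //; exact: measurable_edist.
Qed.

(** Every radial projection has norm [s], so the set of the points of norm
    other than [s] has preimage empty under it. *)
Lemma uniform_on_sphere_norm (s : R) (Y : T -> d.-tuple R) : 0 < s ->
  uniform_on_sphere P s Y -> P [set w | enorm (Y w) != s] = 0%E.
Proof.
move=> s0 [mY law]; pose A := [set y : d.-tuple R | enorm y != s].
have mA : measurable A.
  rewrite (_ : A = [set y | enorm y < s] `|` [set y | s < enorm y]).
    by apply: measurableU; apply: ltr_set_measurable => //; exact: measurable_enorm.
  by apply/seteqP; split => y; rewrite /A /= neq_lt => /orP.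
have := law A mA; rewrite (_ : [set x | _ /\ _] = set0); last first.
  apply/seteqP; split => // x [/andP[x0 _]]; rewrite /A /= enorm_escale.
    by rewrite divfK ?eqxx// gt_eqF.
  by rewrite divr_ge0 ?ltW.
rewrite measure0 => /eqP; rewrite mule_eq0 => /orP[/eqP //|/eqP ball0].
by have := eball_volume_gt0 R d s s0; rewrite ball0 ltxx.
Qed.

End void_events.

(** * The escape probability *)

Section conditioned_model.
Context {R : realType} {disp : measure_display} {T : measurableType disp}.
Context (P : probability T R) {d : nat} (lambda r eps : R).
Context (X0 : T -> d.-tuple R) (Phi : T -> set (d.-tuple R)).
Context (Y : T -> d.-tuple R).
Hypothesis model : inradius_model P lambda r eps X0 Phi Y.

Let escape : set T :=
  [set w | ~ voronoi_cell ([set X0 w] `|` Phi w) (Y w)].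

Lemma measurable_escape : measurable escape.
Proof.
have [[mX0 _] [ppPhi _ _ _] [mY _] _] := model.
rewrite (_ : escape = [set w | edist (X0 w) (Y w) < enorm (Y w)] `|`
    [set w | exists2 x, Phi w x & edist x (Y w) < enorm (Y w)]).
  apply: measurableU; last exact: measurable_exists_closer.
  by apply: ltr_set_measurable; [exact: measurable_edist|exact: measurable_enorm].
apply/seteqP; split => w; rewrite /escape /=.
  move=> /existsNP[x /not_implyP[[->|Phix]]] /negP; rewrite -ltNge => lt.
    by left.
  by right; exists x.
case=> [lt|[x Phix lt]] cell.
  by have := cell (X0 w) (or_introl erefl); rewrite leNgt lt.
by have := cell x (or_intror Phix); rewrite leNgt lt.
Qed.

Lemma void_test_independent B C : measurable B -> measurable C ->
  (P (void Phi B `&` Y @^-1` C) = P (void Phi B) * P (Y @^-1` C))%E.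
Proof.
move=> mB mC; have ind := model_independent model.
have := ind (tnth [tuple setT; void Phi B; Y @^-1` C]).
rewrite !big_ord_recl big_ord0 !(tnth_nth set0)/= probability_setT mul1e mule1.
move=> <-.
  congr (P _); apply/seteqP; split => w /=.
    move=> [vw Yw] i _; rewrite (tnth_nth set0).
    by case: i => -[|[|[|]]].
  move=> H; split.
    by have := H (@Ordinal 3 1 isT) I; rewrite (tnth_nth set0).
  by have := H (@Ordinal 3 2 isT) I; rewrite (tnth_nth set0).
move=> i; rewrite !(tnth_nth set0); case: i => -[|[|[|//]]] /= _.
- by exists setT; [exact: measurableT|rewrite setTI].
- exact: sigma_pp_void.
- by exists C => //; rewrite setTI.
Qed.

Hypotheses (d2 : (2 <= d)%N) (lambda0 : 0 < lambda) (r0 : 0 < r) (eps0 : 0 < eps).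
Variable K : nat.
Hypotheses (K0 : (0 < K)%N) (Kr : K%:R ^+ 2 * eps <= r).

Let delta : R := expR (- (lambda * (K%:R * (eps / (4 * d%:R)) ^+ d))).

(** If the cell meets the sphere at [y0], the region of [crescent_volume] for
    [y0] works for every test point of the cell; otherwise the test point is
    almost surely not in the cell. *)
Lemma cell_no_escape C : measurable C ->
  (forall y y', C y -> C y' -> edist y y' < eps / 4) ->
  (P (~` escape `&` Y @^-1` C) <= delta%:E * P (Y @^-1` C))%E.
Proof.
move=> mC diamC; have [_ poi uY _] := model.
have [ppPhi _ _ _] := poi; have [mY _] := uY.
have s0 : 0 < r + eps by rewrite addr_gt0.
have mYC : measurable (Y @^-1` C) by rewrite -[X in measurable X]setTI; exact: mY.
have mE : measurable (~` escape `&` Y @^-1` C).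
  by apply: measurableI => //; apply: measurableC; exact: measurable_escape.
pose Z := [set w | enorm (Y w) != r + eps].
have mZ : measurable Z.
  rewrite (_ : Z = [set w | enorm (Y w) < r + eps] `|` [set w | r + eps < enorm (Y w)]).
    by apply: measurableU; apply: ltr_set_measurable => //; exact: measurable_enorm.
  by apply/seteqP; split => y; rewrite /Z /= neq_lt => /orP.
have PZ : P Z = 0%E by exact: uniform_on_sphere_norm.
have [[y0 [Cy0 y0s]]|none] := pselect (exists y, C y /\ enorm y = r + eps); last first.
  apply: (@le_trans _ _ (P Z)); last by rewrite PZ mule_ge0// lee_fin expR_ge0.
  apply: le_measure; rewrite ?inE// => w [_ Cw]; apply/eqP => Yw.
  by apply: none; exists (Y w).
have [B [mB BD vB near]] := crescent_volume R d r eps K y0 d2 r0 eps0 Kr y0s.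
have v0 : 0 < lambda * (K%:R * (eps / (4 * d%:R)) ^+ d).
  rewrite !mulr_gt0 ?ltr0n ?exprn_gt0 ?divr_gt0 ?mulr_gt0 ?ltr0n//.
  exact: ltn_trans d2.
rewrite -(poisson_void P lambda _ _ Phi B poi mB BD vB v0) -void_test_independent//.
have mV := measurable_void Phi B ppPhi mB.
apply: (@le_trans _ _ (P (Z `|` (void Phi B `&` Y @^-1` C)))).
  apply: le_measure; rewrite ?inE//.
    by apply: measurableU => //; exact: measurableI.
  move=> w [/contrapT cell Cw]; have [Yw|Yw] := eqVneq (enorm (Y w)) (r + eps).
    right; split => //; apply/seteqP; split => // x [Phix Bx].
    have := near x (Y w) Bx Yw (diamC _ _ Cy0 Cw).
    by rewrite ltNge (cell x (or_intror Phix)).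
  by left.
apply: (@le_trans _ _ (P Z + P (void Phi B `&` Y @^-1` C))%E).
  by apply: measureU2 => //; exact: measurableI.
by rewrite PZ add0e.
Qed.

Lemma no_escape_le : (P (~` escape) <= delta%:E)%E.
Proof.
have [p pdense] := @dense_sequence R d.
pose C := seqDU (fun n => [set y : d.-tuple R | edist y (p n) < eps / 8]).
have mC n : measurable (C n).
  by apply: seqDU_measurable => k; apply: ltr_set_measurable => //; exact: measurable_edist.
have diamC n y y' : C n y -> C n y' -> edist y y' < eps / 4.
  move=> [/= yn _] [/= y'n _]; have := edist_triangle (p n) y y'.
  by rewrite (edistC (p n) y'); lra.
have coverC : \bigcup_n C n = setT.
  rewrite -seqDU_bigcup_eq; apply/seteqP; split => // y _.
  have [n yn] := pdense (eps / 8) y (divr_gt0 eps0 (ltr0n R 8)).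
  by exists n.
have [_ _ [mY _] _] := model.
have mYC n : measurable (Y @^-1` C n).
  by rewrite -[X in measurable X]setTI; exact: mY.
have tYC : trivIset setT (fun n => Y @^-1` C n).
  move=> i j _ _ [w [Ci Cj]].
  exact: (trivIset_seqDU _ i j I I (ex_intro _ (Y w) (conj Ci Cj))).
have UYC : \bigcup_n (Y @^-1` C n) = setT by rewrite -preimage_bigcup coverC.
have mE : measurable (~` escape) by apply: measurableC; exact: measurable_escape.
have -> : ~` escape = \bigcup_n (~` escape `&` Y @^-1` C n).
  by rewrite -setI_bigcupr UYC setIT.
rewrite measure_semi_bigcup//; first last.
- by apply: bigcup_measurable => n _; exact: measurableI.
- by move=> i j _ _ [w [[_ Ci] [_ Cj]]]; exact: (tYC i j I I (ex_intro _ w (conj Ci Cj))).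
- by move=> n; exact: measurableI.
apply: (@le_trans _ _ (\sum_(n <oo) delta%:E * P (Y @^-1` C n))%E).
  apply: lee_nneseries => // n _; exact: (cell_no_escape _ (mC n) (diamC n)).
have total : (\sum_(n <oo) P (Y @^-1` C n) = 1)%E.
  by rewrite -measure_semi_bigcup ?UYC//; exact: probability_setT.
by rewrite nneseriesZl// total mule1.
Qed.

Lemma escape_probability_ge : ((1 - delta)%:E <= P escape)%E.
Proof.
have := no_escape_le; rewrite probability_setC; last exact: measurable_escape.
rewrite -(fineK (fin_num_measure P _ measurable_escape)).
by rewrite -EFinB !lee_fin; lra.
Qed.

End conditioned_model.

(** * The limit *)

Theorem theorem4 (R : realType) (d : nat) (hd : (2 <= d)%N)
  (lambda : R) (hlambda : 0 < lambda) (Q : R -> R -> R)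
  (hQ : forall r eps : R, 0 < r -> 0 < eps ->
     is_escape_probability d lambda r eps (Q r eps)) :
  forall eps : R, 0 < eps -> Q r eps @[r --> +oo] --> (1 : R).
Proof.
move=> eps eps0; apply/cvgrPdist_le => e e0.
pose beta := lambda * (eps / (4 * d%:R)) ^+ d.
have beta0 : 0 < beta.
  rewrite mulr_gt0// exprn_gt0// divr_gt0// mulr_gt0// ltr0n.
  exact: ltn_trans hd.
have [K K0 Ke] : exists2 K : nat, (0 < K)%N & expR (- (K%:R * beta)) <= e.
  (* From [1 + t <= exp t], it suffices that [e^-1 <= K * beta]. *)
  pose M := Num.bound (e^-1 / beta).
  exists M.+1 => //; rewrite expRN invf_ple ?posrE ?expR_gt0//.
  apply: le_trans (expR_ge1Dx _); apply: ler_wpDl => //.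
  rewrite -ler_pdivrMr//; apply: ltW.
  apply: lt_le_trans (archi_boundP _) _; last by rewrite ler_nat.
  by rewrite divr_ge0 ?invr_ge0 ?ltW.
near=> r.
have r0 : 0 < r by near: r; exact: nbhs_pinfty_gt.
have Kr : K%:R ^+ 2 * eps <= r by near: r; apply: nbhs_pinfty_ge; exact: num_real.
have [disp [T [P [X0 [Phi [Y [model PQ]]]]]]] := hQ r eps r0 eps0.
have mE := measurable_escape P lambda r eps X0 Phi Y model.
have := probability_le1 P mE; rewrite PQ lee_fin => Q1.
have := escape_probability_ge P lambda r eps X0 Phi Y model hd hlambda r0 eps0 K K0 Kr.
rewrite PQ lee_fin mulrCA => Q0.
by rewrite ger0_norm ?subr_ge0// lerBlDr -lerBlDl; apply: le_trans Q0; rewrite lerB.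
Unshelve. all: by end_near.
Qed.
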